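(* Let $G$ be a metric group, let $\epsilon>0$, let $\beta\geq 2048\epsilon$, let $C>0$, and let $X,Y\subset G$ be subsets such that $\nu_\epsilon(XY)\leq C\sigma_\beta(X)^{1/2}\sigma_\beta(Y)^{1/2}$. Then there exist a $(16C^{16},256\epsilon)$-rough approximate subgroup $H\subset G$ and sets $K,L\subset G$ of sizes at most $256C^{32}$ and $2048C^{48}$ respectively, such that $KH$ is a $584\epsilon$-net of $X$, $HL$ is a $2304\epsilon$-net of $Y$, and $\nu_{128\epsilon}(H)\leq 8C^{15}\sigma_\beta(X)^{1/2}\sigma_\beta(Y)^{1/2}$.
   Context: A metric group is a group with a bi-invariant metric $d$ (possibly taking the value $+\infty$). For subsets $S,\Delta$, $\Delta$ is an $\eta$-net of $S$ if for every $s\in S$ there is $t\in\Delta$ with $d(s,t)<\eta$. $\nu_\eta(S)$ is the smallest size of an $\eta$-net of $S$; $\sigma_\eta(S)$ is the largest size of a subset $\Gamma\subset S$ with $d(s,s')\geq\eta$ for all distinct $s,s'\in\Gamma$. For $U\subset G$, $U_\eta=\{g:d(g,U)\leq\eta\}$. A subset $H$ is a $(k,\eta)$-rough approximate subgroup if there is a set $K'$ of size at most $k$ with $HH\subset(K'H)_\eta$. Product sets are $AB=\{ab:a\in A,b\in B\}$.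
   Formalization: The formal theorem assumes X and Y are nonempty and ν_ε(XY) is finite; as stated the claim fails if exactly one of X, Y is empty, or for infinite sizes with small C (e.g. X=Y=G infinite with d=+∞ off the diagonal, C=1/10). *)

(* Defs.v *)
From HB Require Import structures.
From mathcomp Require Import all_boot all_order all_algebra finmap.
From mathcomp Require Import all_classical all_reals all_analysis.

Set Implicit Arguments.
Unset Strict Implicit.
Unset Printing Implicit Defensive.

Import Order.TTheory GRing.Theory Num.Theory.

Local Open Scope classical_set_scope.
Local Open Scope ring_scope.
Local Open Scope ereal_scope.

HB.mixin Record Group_isMetricGroup (R : realType) G & Group G := {
  gdist : G -> G -> \bar R ;
  gdist_ge0 : forall x y : G, 0 <= gdist x y ;
  gdist_eq0 : forall x y : G, gdist x y = 0 <-> x = y ;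
  gdistC : forall x y : G, gdist x y = gdist y x ;
  gdist_triangle : forall x y z : G, gdist x z <= gdist x y + gdist y z ;
  gdistMl : forall g x y : G, gdist (g * x)%g (g * y)%g = gdist x y ;
  gdistMr : forall g x y : G, gdist (x * g)%g (y * g)%g = gdist x y }.

#[short(type="metricGroupType")]
HB.structure Definition MetricGroup (R : realType) :=
  {G of Group G & Group_isMetricGroup R G}.

Section MetricGroupDefs.
Context {R : realType} {G : metricGroupType R}.
Implicit Types (S U A B H : set G) (eta k : R).

Definition prodset A B : set G := [set (a * b)%g | a in A & b in B].

Definition is_net eta (D S : set G) : Prop :=
  forall s, S s -> exists2 t, D t & gdist s t < eta%:E.

Definition separated eta (D : set G) : Prop :=
  forall s t, D s -> D t -> s <> t -> eta%:E <= gdist s t.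

(* The net need not be contained in S; the value is +oo when S has no finite
   eta-net. *)
Definition nu eta S : \bar R :=
  ereal_inf [set (#|` D|%:R)%:E
            | D in [set D : {fset G} | is_net eta [set` D] S]].

(* The value is +oo when S has arbitrarily large finite separated subsets. *)
Definition sigma eta S : \bar R :=
  ereal_sup [set (#|` D|%:R)%:E
            | D in [set D : {fset G} |
                     [set` D] `<=` S /\ separated eta [set` D]]].

Definition dist_to_set (g : G) U : \bar R := ereal_inf [set gdist g u | u in U].

Definition thickening eta U : set G := [set g | dist_to_set g U <= eta%:E].

Definition rough_approx_subgroup k eta H : Prop :=
  exists2 K' : {fset G}, (#|` K'|%:R <= k)%R &
    prodset H H `<=` thickening eta (prodset [set` K'] H).

End MetricGroupDefs.

(* Main.v *)
(** Let A and B be beta-separated subsets of X and Y of maximal size, with a and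
    b elements, and let D be an epsilon-net of XY with n elements.  Passing to
    (Y^-1, X^-1) if necessary, assume a <= b.

    By Cauchy-Schwarz, at least (ab)^2 / n quadruples satisfy x y ~ x' y', that
    is x'^-1 x ~ y' y^-1.  Let Z be the symmetric set of those g which have at
    least t = (5/6) b^2 / n approximate representations y' y^-1 over B; counting
    quadruples, Z contains a well separated set Gam with at least (1/6) ab / n
    elements.  Inserting the representations of z in a product v z w splits it
    as (v y') (y^-1 w), so a separated subset of V Z W has at most
    sigma(V B) sigma(B^-1 W) / t elements.  As sigma(Y^-1 Y) <= n^2 / a by
    Ruzsa's triangle inequality, iterating this bounds the separated subsets of
    Z^5 by (n^2 / a)^4 b^2 / t^5.  Ruzsa's covering lemma with the translates of
    Gam then shows that H = ZZ is a rough approximate subgroup, and it covers X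
    and Y in the same way.  The proportion 5/6 minimises 1 / (tau^5 (1 - tau)),
    whose minimum 6 (6/5)^5 is below the required constant 16. *)

Require Import Defs.
From HB Require Import structures.
From mathcomp Require Import all_boot all_order all_algebra finmap.
From mathcomp Require Import all_classical all_reals all_analysis.
From mathcomp Require Import ring lra.

Set Implicit Arguments.
Unset Strict Implicit.
Unset Printing Implicit Defensive.

Import Order.TTheory GRing.Theory Num.Theory.

Local Open Scope classical_set_scope.
Local Open Scope ring_scope.

(** * Counting in finite sets *)

Section FsetCounting.
Implicit Types T U : choiceType.

Lemma card_fset_filter T (A : {fset T}) (P : pred T) :
  #|` [fset x in A | P x]%fset| = (\sum_(x <- A) P x)%N.
Proof.
rewrite card_fset_sum1 big_fset /= big_mkcond.
by apply: eq_bigr => x _; case: (P x).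
Qed.

Lemma card_fset_fibres T U (h : T -> U) (Q : {fset T}) (P : {fset U}) :
  {in Q, forall q, h q \in P} ->
  #|` Q| = (\sum_(p <- P) #|` [fset q in Q | h q == p]%fset|)%N.
Proof.
move=> hP; under eq_bigr do rewrite card_fset_filter.
rewrite exchange_big /= card_fset_sum1 !big_seq; apply: eq_bigr => q qQ.
rewrite (big_rem _ (hP q qQ)) /= eqxx big_seq big1 // => p.
by rewrite mem_rem_uniq ?fset_uniq// inE eq_sym => /andP[/negPf->].
Qed.

Lemma leq_card_fset_inj T U (f : T -> U) (Q : {fset T}) (P : {fset U}) :
  {in Q, forall q, f q \in P} -> {in Q &, injective f} ->
  (#|` Q| <= #|` P|)%N.
Proof.
move=> fP finj; rewrite -(card_in_imfset imfset_key finj).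
by apply: fsubset_leq_card; apply/fsubsetP => _ /imfsetP[q qQ ->]; apply: fP.
Qed.

Lemma geq_card_fset_fibres (R : realType) T U (h : T -> U) (Q : {fset T})
    (P : {fset U}) (k : R) :
  {in Q, forall q, h q \in P} ->
  (forall p, p \in P -> k <= #|` [fset q in Q | h q == p]%fset|%:R) ->
  #|` P|%:R * k <= #|` Q|%:R.
Proof.
move=> /card_fset_fibres-> Pk; rewrite natr_sum card_fset_sum1 natr_sum.
by rewrite mulr_suml !big_seq; apply: ler_sum => p pP; rewrite mul1r Pk.
Qed.

Lemma card_fsetM T U (A : {fset T}) (B : {fset U}) :
  #|` (A `*` B)%fset| = (#|` A| * #|` B|)%N.
Proof.
rewrite (@card_fset_fibres _ _ fst _ A); last first.
  by move=> q; rewrite in_fsetM => /andP[].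
rewrite (card_fset_sum1 A) big_distrl /= !big_seq; apply: eq_bigr => a aA.
rewrite mul1n; apply/eqP; rewrite eqn_leq; apply/andP; split.
  apply: (@leq_card_fset_inj _ _ snd) => [q|[q1 q2] [r1 r2]].
    by rewrite !inE /= => /andP[/andP[]].
  by rewrite !inE /= => /andP[_ /eqP->] /andP[_ /eqP->] ->.
apply: (@leq_card_fset_inj _ _ (fun b => (a, b))) => [b bB|b c _ _ [->]//].
by rewrite !inE /= aA bB eqxx.
Qed.

(** Meant for [h] sending a pair to a net point near its product, so that a collision is a pair of
    nearby products. *)
Lemma collision_lower_bound (R : realType) T U (h : T -> U) (W : {fset T})
    (D : {fset U}) :
  {in W, forall w, h w \in D} -> (0 < #|` D|)%N ->
  #|` W|%:R ^+ 2 / #|` D|%:R <=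
  #|` [fset ww in W `*` W | h ww.1 == h ww.2]%fset|%:R :> R.
Proof.
move=> hD D0; set Q := [fset _ in _ | _]%fset.
have QD : {in Q, forall ww, h ww.1 \in D}.
  by move=> ww; rewrite !inE /= => /andP[/andP[/hD]].
rewrite (card_fset_fibres QD) natr_sum.
(* The mean fibre size, for which the linear bound below is sharpest. *)
set m : R := #|` W|%:R / #|` D|%:R.
have D0' : #|` D|%:R != 0 :> R by rewrite pnatr_eq0 -lt0n.
(* Cauchy-Schwarz, in the form c ^ 2 >= 2 m c - m ^ 2 summed over D. *)
pose c d : R := #|` [fset w in W | h w == d]%fset|%:R.
have -> : #|` W|%:R ^+ 2 / #|` D|%:R = \sum_(d <- D) (2 * m * c d - m ^+ 2) :> R.
  rewrite sumrB -mulr_sumr /c -natr_sum -(card_fset_fibres hD).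
  rewrite (eq_bigr (fun d => m ^+ 2 * 1%N%:R)) => [|d _]; last by rewrite mulr1.
  by rewrite -mulr_sumr -natr_sum -card_fset_sum1 /m; field.
apply: ler_sum => d _; apply: (@le_trans _ _ (c d ^+ 2)).
  by rewrite -subr_ge0; have := sqr_ge0 (c d - m); lra.
rewrite /c -natrX ler_nat -mulnn -card_fsetM.
apply: (@leq_card_fset_inj _ _ id) => // -[w w'].
rewrite !inE /= => /andP[/andP[wW /eqP hw] /andP[w'W /eqP hw']].
by rewrite wW w'W hw hw' eqxx.
Qed.

Lemma exists_max_fset T (P : set {fset T}) (m : nat) (D0 : {fset T}) :
  P D0 -> (forall D, P D -> (#|` D| <= m)%N) ->
  exists2 D, P D & forall D', P D' -> (#|` D'| <= #|` D|)%N.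
Proof.
move=> PD0 Pm; pose q := [pred k | `[< exists2 D, P D & #|` D| = k >]].
have exq : exists k, q k by exists #|` D0|; apply/asboolP; exists D0.
have qm k : q k -> (k <= m)%N by move=> /asboolP[D /Pm + <-].
case: (ex_maxnP exq qm) => k /asboolP[D PD Dk] kmax.
exists D => // D' PD'; rewrite Dk; apply: kmax; apply/asboolP; by exists D'.
Qed.

End FsetCounting.

(* The [separated] of mathcomp-analysis shadows the one of [Defs]. *)
Local Notation separated := Defs.separated.

(** * Approximate equality in a metric group *)

Section MetricGroupCounting.
Context {R : realType} {G : metricGroupType R}.
Implicit Types (x y z u v w g : G) (r eta delta eps beta m t : R).
Implicit Types (S V W X Y : set G) (A B D F Q : {fset G}).

(** Strict, as in [is_net], so that it negates the inequality in [separated]; boolean, so that it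
    can cut out finite sets. *)
Definition near r x y : bool := (gdist x y < r%:E)%E.

Lemma near_refl r x : 0 < r -> near r x x.
Proof. by move=> r0; rewrite /near (gdist_eq0 x x).2 // lte_fin. Qed.

Lemma near_sym r x y : near r x y = near r y x.
Proof. by rewrite /near gdistC. Qed.

Lemma near_le r s x y : r <= s -> near r x y -> near s x y.
Proof. by move=> rs /lt_le_trans; apply; rewrite lee_fin. Qed.

Lemma near_trans r s x y z : near r x y -> near s y z -> near (r + s) x z.
Proof.
move=> xy yz; apply: le_lt_trans (gdist_triangle x y z) _.
by rewrite EFinD; apply: lteD.
Qed.

Lemma nearMl r g x y : near r (g * x)%g (g * y)%g = near r x y.
Proof. by rewrite /near gdistMl. Qed.

Lemma nearMr r g x y : near r (x * g)%g (y * g)%g = near r x y.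
Proof. by rewrite /near gdistMr. Qed.

Lemma nearV r x y : near r x^-1%g y^-1%g = near r x y.
Proof.
by rewrite -(nearMl r x) -(nearMr r y) mulgV mul1g mulgVK near_sym.
Qed.

Lemma near_mul r s x y u v :
  near r x y -> near s u v -> near (r + s) (x * u)%g (y * v)%g.
Proof.
by move=> xy uv; apply: (@near_trans _ _ _ (y * u)%g); rewrite ?nearMr ?nearMl.
Qed.

Lemma near_mid r s x y z : near r x z -> near s y z -> near (r + s) x y.
Proof. by move=> xz; rewrite near_sym => /(near_trans xz). Qed.

(** This is how the injectivity proofs below recover a point of a separated set from an
    approximation to it. *)
Lemma separated_near_eq eta S r x y :
  separated eta S -> S x -> S y -> near r x y -> r <= eta -> x = y.
Proof.
move=> sepS Sx Sy xy reta; apply/eqP/negPn/negP => /eqP /(sepS _ _ Sx Sy).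
by rewrite leNgt; move: (near_le reta xy); rewrite /near => ->.
Qed.

(** * Inverses of sets *)

Definition invset S : set G := [set x^-1%g | x in S].

Lemma invsetP S x : S x -> invset S x^-1%g.
Proof. by exists x. Qed.

Lemma separated_invset eta S : separated eta S -> separated eta (invset S).
Proof.
move=> sepS _ _ [x Sx <-] [y Sy <-] xy.
rewrite leNgt; apply/negP => near_xy; apply: xy; congr (_^-1)%g.
apply: (separated_near_eq sepS Sx Sy (r := eta)) => //.
by rewrite -nearV.
Qed.

Definition inv_fset D : {fset G} := [fset x^-1%g | x in D]%fset.

Lemma mem_inv_fset D x : (x \in inv_fset D) = (x^-1%g \in D).
Proof.
apply/imfsetP/idP => [[y yD ->]|xD]; first by rewrite invgK.
by exists x^-1%g => //; rewrite invgK.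
Qed.

Lemma card_inv_fset D : #|` inv_fset D| = #|` D|.
Proof. by rewrite card_imfset //=; apply: invg_inj. Qed.

Lemma set_inv_fset D : [set` inv_fset D] = invset [set` D].
Proof.
apply/seteqP; split => x /=.
  by rewrite mem_inv_fset => xD; exists x^-1%g => //; rewrite invgK.
by move=> [y /= yD <-]; rewrite mem_inv_fset invgK.
Qed.

(** * Separated subsets, nets and Ruzsa covering *)

(* [sigma delta S <= m], avoiding extended reals. *)
Definition sep_bound delta S m : Prop :=
  forall D, [set` D] `<=` S -> separated delta [set` D] -> #|` D|%:R <= m.

Lemma sep_bound_le delta eta S m :
  delta <= eta -> sep_bound delta S m -> sep_bound eta S m.
Proof.
move=> de bS D DS sepD; apply: bS => // x y Dx Dy /(sepD _ _ Dx Dy).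
by apply: le_trans; rewrite lee_fin.
Qed.

Lemma sep_bound_sub delta S V m :
  V `<=` S -> sep_bound delta S m -> sep_bound delta V m.
Proof. by move=> VS bS D DV; apply: bS; apply: subset_trans VS. Qed.

Lemma sep_bound_fset delta D : sep_bound delta [set` D] #|` D|%:R.
Proof.
by move=> E ED _; rewrite ler_nat; apply: fsubset_leq_card; apply/fsubsetP.
Qed.

Lemma sep_bound_invset delta S m :
  sep_bound delta S m -> sep_bound delta (invset S) m.
Proof.
move=> bS D DS sepD; rewrite -card_inv_fset; apply: bS => [x /=|].
  by rewrite mem_inv_fset => /DS[y Sy /invg_inj<-].
by rewrite set_inv_fset; apply: separated_invset.
Qed.

Lemma net_choice delta S (E : {fset G}) : is_net delta [set` E] S ->
  exists f : G -> G, forall s, S s -> f s \in E /\ near delta s (f s).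
Proof.
move=> net.
have ex s : exists d, S s -> d \in E /\ near delta s d.
  have [/net[d dD sd]|] := pselect (S s); first by exists d.
  by exists s.
by have [f fP] := choice ex; exists f.
Qed.

(** Two points of [S] that share a net point are less than [2 * eps] apart. *)
Lemma sep_bound_net eps D S : is_net eps [set` D] S ->
  sep_bound (2 * eps) S #|` D|%:R.
Proof.
move=> netD E ES sepE; rewrite ler_nat.
have [f fP] := net_choice netD.
apply: (@leq_card_fset_inj _ _ f) => [x /ES/fP[]//|x y xE yE fxy].
have [_ nx] := fP x (ES _ xE); have [_ ny] := fP y (ES _ yE).
apply: (separated_near_eq sepE xE yE (r := eps + eps)); last by lra.
by apply: near_mid nx _; rewrite fxy.
Qed.

(* Ruzsa's covering lemma. *)
Lemma sep_bound_cover delta S (Gam : {fset G}) m :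
  0 < delta -> (0 < #|` Gam|)%N -> separated delta [set` Gam] ->
  sep_bound delta (prodset S [set` Gam]) m ->
  exists2 F, #|` F|%:R * #|` Gam|%:R <= m &
    [set` F] `<=` S /\
    forall s, S s -> exists f g g', [/\ f \in F, g \in Gam, g' \in Gam &
      near delta s (f * g * g'^-1)%g].
Proof.
move=> delta0 Gam0 sepG bS.
(* The translates [f * Gam] are pairwise [delta]-apart, so their union is a separated set with
   [#|F| * #|Gam|] points. A maximal such [F] will cover. *)
pose P F := [set` F] `<=` S /\ forall f f' g g', f \in F -> f' \in F ->
  g \in Gam -> g' \in Gam -> near delta (f * g)%g (f' * g')%g -> f = f'.
have PM F : P F -> #|` F|%:R * #|` Gam|%:R <= m.
  move=> [FS sepF].
  have inj : {in (F `*` Gam)%fset &, injective (fun p : G * G => p.1 * p.2)%g}.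
    move=> [f g] [f' g']; rewrite !in_fsetM /= => /andP[fF gG] /andP[f'F g'G] e.
    have ff' : f = f'.
      by apply: (sepF f f' g g') => //; rewrite e near_refl.
    by move: e; rewrite ff' => /mulgI->.
  rewrite -natrM -card_fsetM -(card_in_imfset imfset_key inj) /=.
  apply: bS => [_ /imfsetP[[f g] /= + ->]|].
    by rewrite in_fsetM => /andP[/= /FS Sf gG]; exists f => //; exists g.
  move=> _ _ /imfsetP[[f g] /= + ->] /imfsetP[[f' g'] /= + ->] /=.
  rewrite !in_fsetM /= => /andP[fF gG] /andP[f'F g'G] ne.
  rewrite leNgt; apply/negP => nfg; apply: ne.
  have ff' : f = f' by apply: (sepF f f' g g').
  move: nfg; rewrite ff' -/(near _ _ _) nearMl.
  by move=> /(separated_near_eq sepG gG g'G) ->.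
have m0 : 0 <= m by apply: le_trans (PM fset0 _); rewrite ?cardfs0 ?mul0r.
have PB F : P F -> (#|` F| <= Num.trunc m)%N.
  move=> /PM Fm; rewrite -[leqLHS](@natrK R); apply: le_truncn.
  apply: le_trans Fm; rewrite ler_peMr // ler1n//.
have [|F PF maxF] := @exists_max_fset _ P _ fset0 _ PB; first by [].
exists F; first exact: PM.
split; first by case: PF.
(* If [s] is not covered, its translate of [Gam] is far from the others, and [s] can be added to
   [F]. *)
move=> s Ss; apply: contrapT => nocover.
have sF : s \notin F.
  apply/negP => sF; have /fset0Pn[g gG] : Gam != fset0 by rewrite -cardfs_gt0.
  by apply: nocover; exists s, g, g; split=> //; rewrite mulgK near_refl.
have nos f g g' : f \in F -> g \in Gam -> g' \in Gam ->
    ~ near delta (s * g')%g (f * g)%g.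
  move=> fF gG g'G nr; apply: nocover; exists f, g, g'; split => //.
  by rewrite -(nearMr _ g') mulgVK.
suff /maxF : P (s |` F)%fset by rewrite cardfsU1 sF add1n ltnn.
split=> [f|f f' g g']; first by rewrite /= !inE => /orP[/eqP->//|]; apply: PF.1.
rewrite !inE => /orP[/eqP->|fF] /orP[/eqP->|f'F] gG g'G // nr.
- by case: (nos _ _ _ f'F g'G gG).
- by case: (nos _ _ _ fF gG g'G); rewrite near_sym.
- by apply: (PF.2 _ _ g g').
Qed.

(** A maximal separated set is a net, since any point far from it could be added. *)
Lemma sep_bound_max delta S m : 0 < delta -> sep_bound delta S m ->
  exists D, [/\ [set` D] `<=` S, separated delta [set` D],
    is_net delta [set` D] S & #|` D|%:R <= m].
Proof.
move=> delta0 bS.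
pose P D := [set` D] `<=` S /\ separated delta [set` D].
have PB D : P D -> (#|` D| <= Num.trunc m)%N.
  move=> [DS sepD]; rewrite -[leqLHS](@natrK R).
  by apply: le_truncn; apply: bS.
have [|D [DS sepD] maxD] := @exists_max_fset _ P _ fset0 _ PB; first by split.
exists D; split => //; last exact: bS.
move=> s Ss; apply: contrapT => nonet.
have nos d : d \in D -> (delta%:E <= gdist s d)%E.
  by move=> dD; rewrite leNgt; apply/negP => sd; apply: nonet; exists d.
have sD : s \notin D.
  by apply/negP => /nos; rewrite leNgt -/(near _ _ _) near_refl.
suff /maxD : P (s |` D)%fset by rewrite cardfsU1 sD add1n ltnn.
split=> [d|d d']; rewrite /= !inE; first by case/orP => [/eqP->//|/DS].
move=> /orP[/eqP->|dD] /orP[/eqP->|d'D] // ne; first exact: nos.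
  by rewrite gdistC; apply: nos.
exact: sepD.
Qed.

(** * Popular quotients *)

(** The tolerance [2 * eps] is that of two products sharing a point of an [eps]-net. *)
Definition quot_reps B eps g : {fset G * G} :=
  [fset p in B `*` B | near (2 * eps) g (p.1 * p.2^-1)%g]%fset.

Definition popular B eps t : set G := [set g | t <= #|` quot_reps B eps g|%:R].

Lemma popularV B eps t g : popular B eps t g -> popular B eps t g^-1%g.
Proof.
move=> /le_trans; apply; rewrite ler_nat.
apply: (@leq_card_fset_inj _ _ (fun p => (p.2, p.1))) => [[y' y]|]; last first.
  by move=> [? ?] [? ?] _ _ /= [-> ->].
rewrite !inE /= => /andP[/andP[-> ->] /=].
by rewrite -nearV invgM invgK.
Qed.

(** The first coordinate determines the second: if [y'^-1 g] is within [2 * eps] of both [y^-1] and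
    [w^-1], then [y] and [w] are within [4 * eps]. *)
Lemma card_quot_reps_le B eps beta g :
  separated beta [set` B] -> 4 * eps <= beta ->
  (#|` quot_reps B eps g| <= #|` B|)%N.
Proof.
move=> sepB be; apply: (@leq_card_fset_inj _ _ fst) => [[y' y]|].
  by rewrite !inE /= => /andP[/andP[]].
move=> [y' y] [w' w]; rewrite !inE /= => /andP[/andP[y'B yB] ny].
move=> /andP[/andP[w'B wB] nw] e; rewrite -{}e in nw w'B *; congr (_, _).
apply: (separated_near_eq sepB yB wB (r := 2 * eps + 2 * eps)); last by lra.
by rewrite -nearV -(nearMl _ y'); apply: near_mid; rewrite near_sym; eassumption.
Qed.

(* A popular z has at least t representations z ~ y' y^-1, and each of them
   splits v z w into (v y') (y^-1 w), from which v z w and (y', y) are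
   recovered. *)
Lemma sep_bound_popular B eps beta t S V W d1 d2 m1 m2 :
  0 < d1 -> 0 < d2 -> 0 < t -> separated beta [set` B] ->
  4 * eps <= beta -> 2 * d1 <= beta ->
  sep_bound d1 (prodset V [set` B]) m1 ->
  sep_bound d2 (prodset (invset [set` B]) W) m2 ->
  (forall u, S u -> exists v z w,
    [/\ V v, popular B eps t z, W w & u = (v * z * w)%g]) ->
  sep_bound (2 * (d1 + d2 + 2 * eps)) S (m1 * m2 / t).
Proof.
move=> d10 d20 t0 sepB be bd /(sep_bound_max d10)[D1 [_ _ net1 D1m]].
move=> /(sep_bound_max d20)[D2 [_ _ net2 D2m]] decomp Gam GamS sepG.
have [f1 f1P] := net_choice net1; have [f2 f2P] := net_choice net2.
have [h hP] : exists h : G -> G * G * G, forall u, u \in Gam ->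
    [/\ V (h u).1.1, popular B eps t (h u).1.2, W (h u).2
      & u = ((h u).1.1 * (h u).1.2 * (h u).2)%g].
  have ex u : exists c : G * G * G, u \in Gam ->
      [/\ V c.1.1, popular B eps t c.1.2, W c.2 & u = (c.1.1 * c.1.2 * c.2)%g].
    have [/GamS/decomp[v [z [w vzw]]]|] := pselect (u \in Gam).
      by exists (v, z, w).
    by exists (u, u, u).
  by have [h hP] := choice ex; exists h.
pose Q := [fset p in Gam `*` (B `*` B) |
  near (2 * eps) (h p.1).1.2 (p.2.1 * p.2.2^-1)%g]%fset.
have QE p : p \in Q -> [/\ p.1 \in Gam, p.2.1 \in B, p.2.2 \in B &
    near (2 * eps) (h p.1).1.2 (p.2.1 * p.2.2^-1)%g].
  by case: p => u [y' y]; rewrite !inE /= => /andP[/andP[-> /andP[-> ->]]].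
(* [Q] is counted twice: every [u] in [Gam] has at least [t] representations, and [Q] injects into
   [D1 * D2] through [F]. *)
rewrite ler_pdivlMr //; apply: (@le_trans _ _ #|` Q|%:R).
  apply: (geq_card_fset_fibres (h := fst)) => [p /QE[]//|u uG].
  have [_ + _ _] := hP u uG; move=> /le_trans; apply; rewrite ler_nat.
  apply: (@leq_card_fset_inj _ _ (fun p => (u, p))) => [[y' y]|p q _ _ [->]//].
  by rewrite !inE /= uG eqxx andbT.
apply: (@le_trans _ _ (#|` D1|%:R * #|` D2|%:R)); last by rewrite ler_pM.
rewrite -natrM -card_fsetM ler_nat.
pose F (p : G * (G * G)) :=
  (f1 ((h p.1).1.1 * p.2.1)%g, f2 (p.2.2^-1 * (h p.1).2)%g).
have FE p : p \in Q ->
    [/\ (F p).1 \in D1, near d1 ((h p.1).1.1 * p.2.1)%g (F p).1,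
        (F p).2 \in D2, near d2 (p.2.2^-1 * (h p.1).2)%g (F p).2
      & near (2 * eps + (d1 + d2)) p.1 ((F p).1 * (F p).2)%g].
  move=> /QE[uG y'B yB nz]; have [Vv _ Ww uE] := hP _ uG.
  have [D1f nf1] : (F p).1 \in D1 /\ near d1 ((h p.1).1.1 * p.2.1)%g (F p).1.
    by apply: f1P; exists (h p.1).1.1 => //; exists p.2.1.
  have [D2f nf2] : (F p).2 \in D2 /\ near d2 (p.2.2^-1 * (h p.1).2)%g (F p).2.
    by apply: f2P; exists p.2.2^-1%g; [apply: invsetP|exists (h p.1).2].
  split=> //; apply: (near_trans
    (y := ((h p.1).1.1 * p.2.1 * (p.2.2^-1 * (h p.1).2))%g)).
    by rewrite {1}uE mulgA nearMr -mulgA nearMl.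
  exact: near_mul.
apply: (@leq_card_fset_inj _ _ F) => [p /FE[F1 _ F2 _ _]|p q pQ qQ Fpq].
  by rewrite in_fsetM F1.
have [pG p1B p2B pz] := QE p pQ; have [qG q1B q2B qz] := QE q qQ.
have [_ np1 _ _ np] := FE p pQ; have [_ nq1 _ _ nq] := FE q qQ.
rewrite -Fpq in nq1 nq.
(* Both are within [2 * eps + (d1 + d2)] of the same product, half the separation of [Gam]. Then
   [v], [z], [w] agree, [v * y'] gives [y'], and [z] with [y'] gives [y]. *)
have e1 : p.1 = q.1.
  by apply: (separated_near_eq sepG pG qG (near_mid np nq)); lra.
rewrite -e1 in nq1 qz.
have e2 : p.2.1 = q.2.1.
  apply: (separated_near_eq sepB p1B q1B (r := d1 + d1)); last by lra.
  by rewrite -(nearMl _ (h p.1).1.1); apply: near_mid np1 nq1.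
rewrite -e2 in qz.
have e3 : p.2.2 = q.2.2.
  apply: (separated_near_eq sepB p2B q2B (r := 2 * eps + 2 * eps)); last by lra.
  rewrite -nearV -(nearMl _ p.2.1).
  by apply: near_mid; rewrite near_sym; eassumption.
by case: p q e1 e2 e3 {Fpq pQ qQ pG p1B p2B pz qG q1B q2B qz np1 np nq1 nq}
  => [? [? ?]] [? [? ?]] /= -> -> ->.
Qed.

(* Ruzsa's triangle inequality, from y^-1 y' = (x y)^-1 (x y'). *)
Lemma sep_bound_quotient eps beta X Y A D :
  0 < eps -> 2 * eps <= beta -> [set` A] `<=` X -> (0 < #|` A|)%N ->
  separated beta [set` A] -> is_net eps [set` D] (prodset X Y) ->
  sep_bound (4 * eps) (prodset (invset Y) Y) (#|` D|%:R ^+ 2 / #|` A|%:R).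
Proof.
move=> e0 be AX A0 sepA /net_choice[f fP] Gam GamY sepG.
have [h hP] : exists h : G -> G * G, forall u, u \in Gam ->
    [/\ Y (h u).1, Y (h u).2 & u = ((h u).1^-1 * (h u).2)%g].
  have ex u : exists c : G * G, u \in Gam ->
      [/\ Y c.1, Y c.2 & u = (c.1^-1 * c.2)%g].
    have [/GamY[_ [y Yy <-] [y' Yy' <-]]|] := pselect (u \in Gam).
      by exists (y, y').
    by exists (u, u).
  by have [h hP] := choice ex; exists h.
rewrite ler_pdivlMr ?ltr0n // -natrM -natrX -mulnn -!card_fsetM ler_nat.
pose F (p : G * G) := (f (p.2 * (h p.1).1)%g, f (p.2 * (h p.1).2)%g).
have FE p : p \in (Gam `*` A)%fset ->
    [/\ (F p).1 \in D, near eps (p.2 * (h p.1).1)%g (F p).1, (F p).2 \in D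
      & near (eps + eps) p.1 ((F p).1^-1 * (F p).2)%g].
  rewrite in_fsetM => /andP[pG pA]; have [Y1 Y2 uE] := hP _ pG.
  have [D1f nf1] : (F p).1 \in D /\ near eps (p.2 * (h p.1).1)%g (F p).1.
    by apply: fP; exists p.2; [apply: AX|exists (h p.1).1].
  have [D2f nf2] : (F p).2 \in D /\ near eps (p.2 * (h p.1).2)%g (F p).2.
    by apply: fP; exists p.2; [apply: AX|exists (h p.1).2].
  split=> //; rewrite {1}uE -[X in near _ (_ * X)%g _](mulKg p.2) mulgA -invgM.
  by apply: near_mul => //; rewrite nearV.
apply: (@leq_card_fset_inj _ _ F) => [p /FE[F1 _ F2 _]|p q pQ qQ Fpq].
  by rewrite in_fsetM F1.
have [_ np1 _ np] := FE p pQ; have [_ nq1 _ nq] := FE q qQ.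
move: pQ qQ; rewrite !in_fsetM => /andP[pG pA] /andP[qG qA].
rewrite -Fpq in nq1 nq.
(* The two net points determine [u], hence the chosen [y], and then [x] is recovered from
   [x * y]. *)
have e1 : p.1 = q.1.
  by apply: (separated_near_eq sepG pG qG (near_mid np nq)); lra.
rewrite -e1 in nq1.
have e2 : p.2 = q.2.
  apply: (separated_near_eq sepA pA qA (r := eps + eps)); last by lra.
  by rewrite -(nearMr _ (h p.1).1); apply: near_mid np1 nq1.
by case: p q e1 e2 {Fpq pG pA qG qA np1 np nq1 nq} => [? ?] [? ?] /= -> ->.
Qed.

(** Write a, b, n for the sizes of [A], [B], [D]. Unpopular pairs of [A * A] account for at most the
    share [tau] of the (ab)^2 / n quadruples. Each popular pair accounts for at most b, leaving (1 -
    tau) a^2 b / n popular pairs, and at most a of them share a point of [Gam]. *)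
Lemma popular_large eps beta delta (tau : R) X Y A B D :
  0 < eps -> 4 * eps <= beta -> 0 < delta -> 2 * delta <= beta -> 0 <= tau ->
  [set` A] `<=` X -> [set` B] `<=` Y -> (0 < #|` A|)%N -> (0 < #|` B|)%N ->
  separated beta [set` A] -> separated beta [set` B] ->
  is_net eps [set` D] (prodset X Y) ->
  exists Gam : {fset G},
    [/\ [set` Gam] `<=` popular B eps (tau * #|` B|%:R ^+ 2 / #|` D|%:R),
        separated delta [set` Gam] &
        (1 - tau) * #|` A|%:R * #|` B|%:R / #|` D|%:R <= #|` Gam|%:R].
Proof.
move=> e0 be de bd tau0 AX BY A0 B0 sepA sepB netD.
have [f fP] := net_choice netD.
set t := tau * _ / _.
pose W := (A `*` B)%fset.
pose c (w : G * G) := f (w.1 * w.2)%g.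
have cP (w : G * G) : w \in W -> c w \in D /\ near eps (w.1 * w.2)%g (c w).
  rewrite in_fsetM => /andP[/AX wA /BY wB].
  by apply: fP; exists w.1 => //; exists w.2.
have D0 : (0 < #|` D|)%N.
  move: A0 B0; rewrite !cardfs_gt0 => /fset0Pn[x xA] /fset0Pn[y yB].
  apply/fset0Pn; exists (c (x, y)).
  by have [] := cP (x, y); rewrite // in_fsetM xA yB.
pose Q := [fset q in (A `*` A) `*` (B `*` B) |
  near (2 * eps) (q.1.1^-1 * q.1.2)%g (q.2.1 * q.2.2^-1)%g]%fset.
have lowQ : (#|` A|%:R * #|` B|%:R) ^+ 2 / #|` D|%:R <= #|` Q|%:R :> R.
  have cD : {in W, forall p, c p \in D} by move=> p /cP[].
  rewrite -natrM -card_fsetM.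
  apply: le_trans (collision_lower_bound R cD D0) _; rewrite ler_nat.
  (* A collision of [x y] with [x' y'] becomes the quadruple with [x'^-1 x] near [y' y^-1]. *)
  apply: (@leq_card_fset_inj _ _ (fun p => ((p.2.1, p.1.1), (p.2.2, p.1.2)))).
    move=> [[x y] [x' y']]; rewrite in_fset /= inE /= in_fsetM /=.
    move=> /andP[/andP[w1 w2] /eqP cw].
    have [_ n1] := cP _ w1; have [_ n2] := cP _ w2; rewrite -cw in n2.
    move: w1 w2; rewrite !inE /= => /andP[-> ->] /andP[-> ->] /=.
    have := near_mid n1 n2; rewrite /= -(nearMl _ x'^-1%g) -(nearMr _ y^-1%g).
    by rewrite !mulgA mulgK mulVg mul1g; apply: near_le; lra.
  by move=> [[x y] [x' y']] [[u v] [u' v']] _ _ /= [-> -> -> ->].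
pose pop := [fset p in A `*` A |
  t <= #|` quot_reps B eps (p.1^-1 * p.2)%g|%:R]%fset.
have upQ : #|` Q|%:R <= #|` pop|%:R * #|` B|%:R + #|` A|%:R ^+ 2 * t.
  have QAA : {in Q, forall q, q.1 \in (A `*` A)%fset}.
    by move=> [q1 q2]; rewrite in_fset /= inE /= in_fsetM => /andP[/andP[]].
  rewrite (card_fset_fibres QAA) natr_sum /pop card_fset_filter natr_sum.
  rewrite mulr_suml -natrX -mulnn -card_fsetM (card_fset_sum1 (A `*` A)%fset).
  rewrite [X in _ <= _ + X * t]natr_sum.
  rewrite mulr_suml -big_split /= !big_seq; apply: ler_sum => p pAA.
  have fibp : (#|` [fset q in Q | q.1 == p]%fset| <=
      #|` quot_reps B eps (p.1^-1 * p.2)%g|)%N.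
    apply: (@leq_card_fset_inj _ _ snd) => [[q1 q2]|[q1 q2] [r1 r2]].
      rewrite in_fset /= inE /= in_fset /= inE /= in_fsetM /=.
      move=> /andP[/andP[/andP[_ qB] nq] /eqP qp].
      by rewrite -qp !inE /= nq andbT; move: qB; rewrite in_fsetM.
    by rewrite !inE /= => /andP[_ /eqP->] /andP[_ /eqP->] ->.
  have t0 : 0 <= t by rewrite /t divr_ge0 ?mulr_ge0 ?exprn_ge0.
  (* A popular pair has at most [#|B|] representations, an unpopular one fewer than [t]. *)
  rewrite mul1r; case: (leP t) => [tq|qt].
    rewrite /= mul1r; apply: ler_wpDr => //; rewrite ler_nat.
    exact: leq_trans fibp (card_quot_reps_le _ sepB be).
  by rewrite /= mul0r add0r; apply: le_trans (ltW qt); rewrite ler_nat.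
pose E := [fset (p.1^-1 * p.2)%g | p in pop]%fset.
have [Gam [GamE sepG netG _]] := sep_bound_max de (@sep_bound_fset delta E).
exists Gam; split => //.
  by move=> g /GamE /imfsetP[p /= + ->]; rewrite in_fset /= inE /= => /andP[].
have [k kP] := net_choice netG.
(* The first entry of a popular pair and a point of [Gam] near its quotient fix the second entry up
   to [2 * delta]. *)
have popG : (#|` pop| <= #|` Gam| * #|` A|)%N.
  rewrite -card_fsetM.
  pose F (p : G * G) := (k (p.1^-1 * p.2)%g, p.1).
  have kE (p : G * G) : p \in pop -> k (p.1^-1 * p.2)%g \in Gam /\
      near delta (p.1^-1 * p.2)%g (k (p.1^-1 * p.2)%g).
    by move=> pp; apply: kP; apply/imfsetP; exists p.
  have popA (p : G * G) : p \in pop -> p.1 \in A /\ p.2 \in A.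
    by rewrite in_fset /= inE /= in_fsetM => /andP[/andP[]].
  apply: (@leq_card_fset_inj _ _ F) => [p pp|[p1 p2] [q1 q2] pp qp].
    by rewrite in_fsetM /= (kE _ pp).1 (popA _ pp).1.
  move=> /= [ek e1]; subst q1; congr (_, _).
  have [_ np] := kE _ pp; have [_ nq] := kE _ qp; rewrite /= -ek in np nq.
  apply: (separated_near_eq sepA (popA _ pp).2 (popA _ qp).2
    (r := delta + delta)); last by lra.
  by rewrite -(nearMl _ p1^-1%g); apply: near_mid np nq.
have a0 : 0 < #|` A|%:R :> R by rewrite ltr0n.
have b0 : 0 < #|` B|%:R :> R by rewrite ltr0n.
have n0 : 0 < #|` D|%:R :> R by rewrite ltr0n.
move: popG; rewrite -(ler_nat R) natrM => popG.
have := le_trans lowQ upQ; rewrite /t; move: a0 b0 n0 popG.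
move: (#|` A|%:R : R) (#|` B|%:R : R) (#|` D|%:R : R) => a b n.
move: (#|` Gam|%:R : R) (#|` pop|%:R : R) => g p a0 b0 n0 pg.
rewrite ler_pdivrMr // mulrDl.
have -> : a ^+ 2 * (tau * b ^+ 2 / n) * n = tau * (a * b) ^+ 2.
  by field; rewrite gt_eqF.
rewrite ler_pdivrMr // => h.
have : p * b * n <= g * a * b * n by rewrite !ler_wpM2r // ltW.
move=> pgn; rewrite -(ler_pM2l (mulr_gt0 a0 b0)); lra.
Qed.

(** * Transfer by translation and inversion *)

Lemma sep_bound_translate delta X Y m y :
  Y y -> sep_bound delta (prodset X Y) m -> sep_bound delta X m.
Proof.
move=> Yy bXY D DX sepD.
have inj : {in D &, injective (fun x => x * y)%g} by move=> ? ? _ _ /mulIg.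
rewrite -(card_in_imfset imfset_key inj) /=.
apply: bXY => [_ /imfsetP[x /= /DX Xx ->]|]; first by exists x => //; exists y.
move=> _ _ /imfsetP[x /= xD ->] /imfsetP[x' /= x'D ->] ne.
by rewrite gdistMr; apply: sepD => // e; apply: ne; rewrite e.
Qed.

Lemma prodset_invset X Y :
  prodset (invset Y) (invset X) = invset (prodset X Y).
Proof.
apply/seteqP; split => g.
  move=> [_ [y Yy <-] [_ [x Xx <-] <-]]; rewrite -invgM.
  by apply: invsetP; exists x => //; exists y.
move=> [_ [x Xx [y Yy <-]] <-]; rewrite invgM.
by exists y^-1%g; [apply: invsetP|exists x^-1%g => //; apply: invsetP].
Qed.

Lemma invsetK S : invset (invset S) = S.
Proof.
apply/seteqP; split => g; first by move=> [_ [x Sx <-] <-]; rewrite invgK.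
by move=> Sg; rewrite -[g]invgK; do 2!apply: invsetP.
Qed.

Lemma is_net_invset eta S V :
  is_net eta S V -> is_net eta (invset S) (invset V).
Proof.
move=> net _ [v Vv <-]; have [s Ss vs] := net v Vv.
by exists s^-1%g; [apply: invsetP|rewrite -/(near _ _ _) nearV].
Qed.

(** * Construction of the approximate subgroup *)

(** Divides the bound of the covering lemma by a lower bound [gam] for the size of [Gam]; the
    quotient [k] is given by an equation so that [field] can check it. *)
Lemma cover_count (F g gam m k : R) :
  F * g <= m -> 0 <= F -> 0 < gam -> gam <= g -> m = gam * k -> F <= k.
Proof.
move=> Fgm F0 gam0 gg mk; rewrite -(ler_pM2l gam0) -mk.
by apply: le_trans Fgm; rewrite mulrC ler_wpM2l.
Qed.

(** The order of the sizes makes [a / b] at most 1. The symmetry of [H] is recorded so that the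
    opposite order follows by inversion. *)
Lemma approx_subgroup_of_small_product_le eps beta (C : R) X Y A B D :
  0 < eps -> 2048 * eps <= beta -> 1 <= C ->
  [set` A] `<=` X -> [set` B] `<=` Y -> (0 < #|` A|)%N ->
  separated beta [set` A] -> separated beta [set` B] ->
  is_net eps [set` D] (prodset X Y) ->
  #|` D|%:R ^+ 2 <= C ^+ 2 * (#|` A|%:R * #|` B|%:R) ->
  (#|` A| <= #|` B|)%N ->
  exists (H : set G) (K L E : {fset G}),
    [/\ rough_approx_subgroup (16 * C ^+ 16) (256 * eps) H,
        invset H = H,
        #|` K|%:R <= 8 * C ^+ 4 /\ #|` L|%:R <= 8 * C ^+ 4,
        is_net (584 * eps) (prodset [set` K] H) X /\
        is_net (584 * eps) (prodset H [set` L]) Y &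
        is_net (128 * eps) [set` E] H /\
        #|` E|%:R <= 8 * C ^+ 15 * Num.sqrt (#|` A|%:R * #|` B|%:R)].
Proof.
move=> e0 be C1 AX BY A0 sepA sepB netD nC AB.
have B0 : (0 < #|` B|)%N by apply: leq_trans AB.
have be4 : 4 * eps <= beta by lra.
(* In units of [eps], splitting at a popular element gives the scales 14 = 2 (4 + 1 + 2), 40 = 2 (4
   + 14 + 2) and 164 = 2 (40 + 40 + 2). *)
pose delta := 164 * eps; have delta0 : 0 < delta by rewrite /delta; lra.
have delta_beta : 2 * delta <= beta by rewrite /delta; lra.
have tau0 : 0 <= 5 / 6 :> R by lra.
have [Gam [GamZ sepG Gam_ge]] := popular_large e0 be4 delta0 delta_beta tau0
  AX BY A0 B0 sepA sepB netD.
have be2 : 2 * eps <= beta by lra.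
have bM := sep_bound_quotient e0 be2 AX A0 sepA netD.
have D0 : (0 < #|` D|)%N.
  move: A0 B0; rewrite !cardfs_gt0 => /fset0Pn[x xA] /fset0Pn[y yB].
  have [|d dD _] := netD (x * y)%g; last by apply/fset0Pn; exists d.
  by exists x; [apply: AX|exists y; [apply: BY|]].
have a0 : 0 < #|` A|%:R :> R by rewrite ltr0n.
have b0 : 0 < #|` B|%:R :> R by rewrite ltr0n.
have n0 : 0 < #|` D|%:R :> R by rewrite ltr0n.
have bn := sep_bound_net netD.
have bB : sep_bound eps [set` B] #|` B|%:R by apply: sep_bound_fset.
have bBV : sep_bound eps (invset [set` B]) #|` B|%:R by apply: sep_bound_invset.
move: AB; rewrite -(ler_nat R) => ab.
set a : R := #|` A|%:R in a0 ab nC bM Gam_ge *.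
set b : R := #|` B|%:R in b0 ab nC Gam_ge bB bBV GamZ *.
set n : R := #|` D|%:R in n0 nC bM Gam_ge bn GamZ *.
set t := 5 / 6 * b ^+ 2 / n in GamZ.
have t0 : 0 < t by rewrite /t divr_gt0 // mulr_gt0 ?exprn_gt0 //; lra.
set Z := popular B eps t in GamZ.
set M := n ^+ 2 / a in bM.
have bBV1 : sep_bound eps (prodset (invset [set` B]) [set 1%g]) b.
  by apply: sep_bound_sub bBV => _ [y By [_ -> <-]]; rewrite mulg1.
have b1B : sep_bound eps (prodset [set 1%g] [set` B]) b.
  by apply: sep_bound_sub bB => _ [_ -> [y By <-]]; rewrite mul1g.
have bYB : sep_bound (4 * eps) (prodset (invset Y) [set` B]) M.
  by apply: sep_bound_sub bM => _ [y Yy [y' /BY Yy' <-]]; exists y => //; exists y'.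
have bXB : sep_bound (2 * eps) (prodset X [set` B]) n.
  by apply: sep_bound_sub bn => _ [x Xx [y /BY Yy <-]]; exists x => //; exists y.
have BYV : invset [set` B] `<=` invset Y.
  by move=> _ [y /BY Yy <-]; apply: invsetP.
have bYZ : sep_bound (14 * eps) (prodset (invset Y) Z) (M * b / t).
  have -> : 14 * eps = 2 * (4 * eps + eps + 2 * eps) by lra.
  apply: (sep_bound_popular _ _ t0 sepB be4 _ bYB bBV1); [lra|lra|lra|].
  move=> _ [y Yy [z Zz <-]]; exists y, z, 1%g; split => //; by rewrite mulg1.
have bBZ : sep_bound (14 * eps) (prodset (invset [set` B]) Z) (M * b / t).
  by apply: sep_bound_sub bYZ => _ [y /BYV Yy [z Zz <-]]; exists y => //; exists z.
pose H := prodset Z Z.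
have bBH : sep_bound (40 * eps) (prodset (invset [set` B]) H)
    (M * (M * b / t) / t).
  have -> : 40 * eps = 2 * (4 * eps + 14 * eps + 2 * eps) by lra.
  apply: (sep_bound_popular _ _ t0 sepB be4 _ bYB bBZ); [lra|lra|lra|].
  move=> _ [y /BYV Yy [_ [z Zz [z' Zz' <-]] <-]].
  by exists y, z, z'; split => //; rewrite mulgA.
have HV : invset H = H.
  have sub : invset H `<=` H.
    move=> _ [_ [z Zz [z' Zz' <-]] <-]; rewrite invgM.
    by exists z'^-1%g; [apply: popularV|exists z^-1%g => //; apply: popularV].
  apply/seteqP; split => // h Hh; rewrite -[h]invgK; apply: invsetP.
  by apply: sub; apply: invsetP.
have bHB : sep_bound (40 * eps) (prodset H [set` B]) (M * (M * b / t) / t).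
  apply: sep_bound_sub (sep_bound_invset bBH).
  by rewrite -[X in prodset _ X]invsetK -{1}HV prodset_invset.
(* [H H Gam] lies in [Z^5 = H Z H]; splitting at the middle factor leaves [H B] and [B^-1 H], both
   already bounded. *)
have bHHG : sep_bound delta (prodset (prodset H H) [set` Gam])
    (M * (M * b / t) / t * (M * (M * b / t) / t) / t).
  have -> : delta = 2 * (40 * eps + 40 * eps + 2 * eps) by rewrite /delta; lra.
  apply: (sep_bound_popular _ _ t0 sepB be4 _ bHB bBH); [lra|lra|lra|].
  move=> _ [_ [h Hh [_ [z Zz [z' Zz' <-]] <-]] [g /GamZ Zg <-]].
  exists h, z, (z' * g)%g; split => //; last by rewrite !mulgA.
  by exists z' => //; exists g.
have bXG : sep_bound delta (prodset X [set` Gam]) (n * b / t).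
  apply: (sep_bound_le (delta := 2 * (2 * eps + eps + 2 * eps))).
    by rewrite /delta; lra.
  apply: (sep_bound_popular _ _ t0 sepB be4 _ bXB bBV1); [lra|lra|lra|].
  by move=> _ [x Xx [z /GamZ Zz <-]]; exists x, z, 1%g; split => //; rewrite mulg1.
have bYG : sep_bound delta (prodset (invset Y) [set` Gam]) (M * b / t).
  apply: (sep_bound_le (delta := 14 * eps)); first by rewrite /delta; lra.
  by apply: sep_bound_sub bYZ => _ [y Yy [z /GamZ Zz <-]]; exists y => //; exists z.
have bH : sep_bound (128 * eps) H (b * (M * b / t) / t).
  apply: (sep_bound_le (delta := 2 * (eps + 14 * eps + 2 * eps))); first lra.
  apply: (sep_bound_popular _ _ t0 sepB be4 _ b1B bBZ); [lra|lra|lra|].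
  by move=> _ [z Zz [z' Zz' <-]]; exists 1%g, z, z'; split => //; rewrite mul1g.
set gam := (1 - 5 / 6) * a * b / n in Gam_ge.
have gam0 : 0 < gam by rewrite /gam divr_gt0 // !mulr_gt0 //; lra.
have Gam0 : (0 < #|` Gam|)%N by rewrite -(ltr0n R); apply: lt_le_trans Gam_ge.
have aN : a != 0 by rewrite gt_eqF.
have bN : b != 0 by rewrite gt_eqF.
have nN : n != 0 by rewrite gt_eqF.
have C0 : 0 <= C by lra.
(* Hence the sets [f Gam Gam^-1] of the covering lemma lie in [f H]. *)
have ZG g g' : g \in Gam -> g' \in Gam -> H (g * g'^-1)%g.
  by move=> /GamZ Zg /GamZ/popularV Zg'; exists g => //; exists g'^-1%g.
have [K' K'm [_ coverH]] := sep_bound_cover delta0 Gam0 sepG bHHG.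
have [K Km [_ coverX]] := sep_bound_cover delta0 Gam0 sepG bXG.
have [L Lm [_ coverY]] := sep_bound_cover delta0 Gam0 sepG bYG.
have [|E [_ _ netE Em]] := sep_bound_max _ bH; first lra.
have n2 : n ^+ 2 <= C ^+ 2 * (a * b) by [].
have r1 : a / b <= 1 by rewrite ler_pdivrMr // mul1r.
have r0 : 0 <= a / b by rewrite divr_ge0 // ltW.
have ab0 : 0 < a * b by rewrite mulr_gt0.
have s1 : n ^+ 2 / (a * b) <= C ^+ 2 by rewrite ler_pdivrMr.
have s0 : 0 <= n ^+ 2 / (a * b) by rewrite divr_ge0 ?exprn_ge0 // ltW.
have CX k : (k <= 16)%N -> C ^+ k <= C ^+ 16 by move=> k16; apply: ler_weXn2l.
have s2 : (n ^+ 2 / (a * b)) ^+ 2 <= C ^+ 4.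
  by rewrite (exprM C 2 2) lerXn2r // nnegrE exprn_ge0.
exists H, K, (inv_fset L), E; split.
- exists K'.
    (* The constant is 6 (6/5)^5, about 14.93, and the seventh power contributes [C ^+ 14]. *)
    have : #|` K'|%:R <= 36 / 25 * (36 / 25) * (36 / 5) *
        ((n ^+ 2 / (a * b)) ^+ 7 * (a / b) ^+ 2).
      apply: (cover_count K'm _ gam0 Gam_ge) => //.
      rewrite /gam /t /M; field; by rewrite aN bN nN.
    move=> /le_trans; apply.
    have p1 : (n ^+ 2 / (a * b)) ^+ 7 <= C ^+ 16.
      apply: le_trans (CX 14%N _) => //.
      by rewrite (exprM C 2 7) lerXn2r // nnegrE exprn_ge0.
    have p2 : (a / b) ^+ 2 <= 1 by rewrite exprn_ile1.
    have : (n ^+ 2 / (a * b)) ^+ 7 * (a / b) ^+ 2 <= C ^+ 16 * 1.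
      by rewrite ler_pM ?exprn_ge0.
    have := exprn_ge0 16 C0; lra.
  move=> u HHu; have [f [g [g' [fK gG g'G nu]]]] := coverH u HHu.
  apply: le_trans (ereal_inf_lbound _) _; first exists (f * (g * g'^-1))%g.
    by exists f => //; exists (g * g'^-1)%g => //; apply: ZG.
    by [].
  rewrite mulgA; apply: ltW; apply: near_le nu; rewrite /delta; lra.
- exact: HV.
- have CD k : (k <= 4)%N -> C ^+ k <= C ^+ 4 by move=> k4; apply: ler_weXn2l.
  split; last first.
    rewrite card_inv_fset.
    have : #|` L|%:R <= 36 / 5 * (n ^+ 2 / (a * b)) ^+ 2.
      apply: (cover_count Lm _ gam0 Gam_ge) => //.
      rewrite /gam /t /M; field; by rewrite aN bN nN.
    have := exprn_ge0 4 C0; lra.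
  have : #|` K|%:R <= 36 / 5 * ((n ^+ 2 / (a * b)) * (n / b)).
    apply: (cover_count Km _ gam0 Gam_ge) => //.
    rewrite /gam /t /M; field; by rewrite aN bN nN.
  (* Since [a <= b], the hypothesis gives [n^2 <= C^2 b^2]. *)
  have nb : n / b <= C.
    rewrite ler_pdivrMr // -(@ler_pXn2r _ 2) ?nnegrE ?mulr_ge0 ?(ltW n0)
      ?(ltW b0) //.
    apply: le_trans n2 _; rewrite exprMn ler_wpM2l ?exprn_ge0 //.
    by rewrite expr2 ler_wpM2r // ltW.
  have : n ^+ 2 / (a * b) * (n / b) <= C ^+ 2 * C.
    by rewrite ler_pM // divr_ge0 // ltW.
  have := CD 3%N isT; rewrite -exprSr; have := exprn_ge0 4 C0; lra.
- split=> [x Xx|y Yy].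
    have [f [g [g' [fK gG g'G nu]]]] := coverX x Xx.
    exists (f * g * g'^-1)%g; last by apply: near_le nu; rewrite /delta; lra.
    by exists f => //; exists (g * g'^-1)%g; [apply: ZG|rewrite mulgA].
  (* The covering is of [Y^-1]; inverting puts [H] on the left and replaces [L] by its inverse. *)
  have [f [g [g' [fK gG g'G nu]]]] := coverY _ (invsetP Yy).
  exists (g' * g^-1 * f^-1)%g.
    exists (g' * g^-1)%g; first exact: ZG.
    by exists f^-1%g => //=; rewrite mem_inv_fset invgK.
  rewrite -/(near _ _ _) -nearV !invgM !invgK mulgA.
  by apply: near_le nu; rewrite /delta; lra.
- split=> //; apply: le_trans Em _.
  have -> : b * (M * b / t) / t = 36 / 25 * ((n ^+ 2 / (a * b)) ^+ 2 * a).
    by rewrite /t /M; field; rewrite aN bN nN.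
  have as' : a <= Num.sqrt (a * b).
    rewrite -[leLHS](gtr0_norm a0) -sqrtr_sqr; apply: ler_wsqrtr.
    by rewrite expr2 ler_wpM2l // ltW.
  have : (n ^+ 2 / (a * b)) ^+ 2 * a <= C ^+ 15 * Num.sqrt (a * b).
    rewrite ler_pM ?exprn_ge0 ?(ltW a0) //.
    by apply: le_trans s2 _; apply: ler_weXn2l.
  have : 0 <= C ^+ 15 * Num.sqrt (a * b) by rewrite mulr_ge0 ?exprn_ge0 ?sqrtr_ge0.
  lra.
Qed.

Lemma approx_subgroup_of_small_product eps beta (C : R) X Y A B D :
  0 < eps -> 2048 * eps <= beta -> 1 <= C ->
  [set` A] `<=` X -> [set` B] `<=` Y -> (0 < #|` A|)%N -> (0 < #|` B|)%N ->
  separated beta [set` A] -> separated beta [set` B] ->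
  is_net eps [set` D] (prodset X Y) ->
  #|` D|%:R ^+ 2 <= C ^+ 2 * (#|` A|%:R * #|` B|%:R) ->
  exists (H : set G) (K L E : {fset G}),
    [/\ rough_approx_subgroup (16 * C ^+ 16) (256 * eps) H,
        #|` K|%:R <= 8 * C ^+ 4 /\ #|` L|%:R <= 8 * C ^+ 4,
        is_net (584 * eps) (prodset [set` K] H) X /\
        is_net (584 * eps) (prodset H [set` L]) Y &
        is_net (128 * eps) [set` E] H /\
        #|` E|%:R <= 8 * C ^+ 15 * Num.sqrt (#|` A|%:R * #|` B|%:R)].
Proof.
move=> e0 be C1 AX BY A0 B0 sepA sepB netD nC.
have [AB|BA] := leqP #|` A| #|` B|.
  have [H [K [L [E [rH _ KL net netE]]]]] := approx_subgroup_of_small_product_le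
    e0 be C1 AX BY A0 sepA sepB netD nC AB.
  by exists H, K, L, E.
have inv_sub (F : {fset G}) S :
    [set` F] `<=` S -> [set` inv_fset F] `<=` invset S.
  by move=> FS; rewrite set_inv_fset => _ [x /FS Sx <-]; apply: invsetP.
have inv_sep (F : {fset G}) : separated beta [set` F] ->
    separated beta [set` inv_fset F].
  by rewrite set_inv_fset; apply: separated_invset.
have [||||H [K [L [E [rH HV [Km Lm] [netK netL] netE]]]]] :=
  approx_subgroup_of_small_product_le (D := inv_fset D) e0 be C1 (inv_sub _ _ BY)
  (inv_sub _ _ AX) _ (inv_sep _ sepB) (inv_sep _ sepA) _ _ _.
- by rewrite card_inv_fset.
- by rewrite prodset_invset set_inv_fset; apply: is_net_invset.
- by rewrite !card_inv_fset [X in _ * X]mulrC.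
- by rewrite !card_inv_fset ltnW.
(* Inversion exchanges the two coverings, and [H = H^-1] turns [(K H)^-1] into [H K^-1]. *)
exists H, (inv_fset L), (inv_fset K), E; rewrite !card_inv_fset; split => //.
  split; rewrite set_inv_fset -HV prodset_invset.
    by rewrite -[X]invsetK; apply: is_net_invset.
  by rewrite -[Y]invsetK; apply: is_net_invset.
by move: netE; rewrite !card_inv_fset [X in Num.sqrt X]mulrC.
Qed.

(** * Extremal nets and separated sets *)

(** Finiteness excludes the empty infimum [+oo], and a nonempty set of sizes has a least element. *)
Lemma nu_attained eta S : (nu eta S < +oo)%E ->
  exists2 D, is_net eta [set` D] S & nu eta S = (#|` D|%:R)%:E.
Proof.
move=> fin.
pose q := [pred k | `[< exists2 D, is_net eta [set` D] S & #|` D| = k >]].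
have exq : exists k, q k.
  apply: contrapT => noq; move: fin; rewrite /nu.
  suff -> : [set D : {fset G} | is_net eta [set` D] S] = set0.
    by rewrite image_set0 ereal_inf0 ltxx.
  apply/seteqP; split => // D netD; apply: noq; exists #|` D|.
  by apply/asboolP; exists D.
case: (ex_minnP exq) => k /asboolP[D netD Dk] kmin; exists D => //.
apply/eqP; rewrite eq_le; apply/andP; split.
  by apply: ereal_inf_lbound; exists D.
apply: le_ereal_inf_tmp => _ [E netE <-]; rewrite lee_fin ler_nat Dk.
by apply: kmin; apply/asboolP; exists E.
Qed.

Lemma sigma_attained delta S m : sep_bound delta S m ->
  exists D, [/\ [set` D] `<=` S, separated delta [set` D] &
    sigma delta S = (#|` D|%:R)%:E].
Proof.
move=> bS; pose P D := [set` D] `<=` S /\ separated delta [set` D].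
have PB D : P D -> (#|` D| <= Num.trunc m)%N.
  move=> [DS sepD]; rewrite -[leqLHS](@natrK R).
  by apply: le_truncn; apply: bS.
have [|D [DS sepD] maxD] := exists_max_fset (P := P) (D0 := fset0) _ PB.
  by split.
exists D; split => //; apply/eqP; rewrite eq_le; apply/andP; split.
  by apply: ge_ereal_sup => _ [E PE <-]; rewrite lee_fin ler_nat; apply: maxD.
by apply: ereal_sup_ubound; exists D.
Qed.

End MetricGroupCounting.

(** * Reduction to finite extremal sets *)

Theorem theoremA5 (R : realType) (G : metricGroupType R)
  (epsilon beta C : R) (X Y : set G)
  (epsilon_gt0 : 0 < epsilon) (beta_ge : 2048 * epsilon <= beta) (C_gt0 : 0 < C)
  (X_neq0 : X !=set0) (Y_neq0 : Y !=set0)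
  (nu_fin : (nu epsilon (prodset X Y) < +oo)%E)
  (nu_le : (nu epsilon (prodset X Y)
            <= C%:E * (sigma beta X `^ 2^-1) * (sigma beta Y `^ 2^-1))%E) :
  exists (H : set G) (K L : {fset G}),
    rough_approx_subgroup (16 * C ^+ 16) (256 * epsilon) H /\
    #|` K|%:R <= 256 * C ^+ 32 /\
    #|` L|%:R <= 2048 * C ^+ 48 /\
    is_net (584 * epsilon) (prodset [set` K] H) X /\
    is_net (2304 * epsilon) (prodset H [set` L]) Y /\
    (nu (128 * epsilon) H
     <= (8 * C ^+ 15)%:E * (sigma beta X `^ 2^-1) * (sigma beta Y `^ 2^-1))%E.
Proof.
have [D netD nuE] := nu_attained nu_fin.
have [x Xx] := X_neq0; have [y Yy] := Y_neq0.
have bXY : sep_bound beta (prodset X Y) #|` D|%:R.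
  by apply: sep_bound_le (sep_bound_net netD); lra.
have bX := sep_bound_translate Yy bXY.
(* [Y] is a right factor, so the translation argument is applied to [Y^-1 X^-1]. *)
have bY : sep_bound beta Y #|` D|%:R.
  rewrite -[Y]invsetK; apply: sep_bound_invset.
  apply: (sep_bound_translate (invsetP Xx)); rewrite prodset_invset.
  exact: sep_bound_invset.
have sigma_gt0 (S : set G) s (F : {fset G}) :
    S s -> sigma beta S = (#|` F|%:R)%:E -> (0 < #|` F|)%N.
  move=> Ss SF; rewrite -(ler_nat R) -lee_fin -SF; apply: ereal_sup_ubound.
  exists [fset s]%fset; last by rewrite cardfs1.
  split=> [z /=|u v /=]; first by rewrite inE => /eqP->.
  by rewrite !inE => /eqP-> /eqP->.
have [A [AX sepA XA]] := sigma_attained bX.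
have [B [BY sepB YB]] := sigma_attained bY.
have A0 := sigma_gt0 _ _ _ Xx XA; have B0 := sigma_gt0 _ _ _ Yy YB.
have powE (c : R) :
    (c%:E * (sigma beta X `^ 2^-1) * (sigma beta Y `^ 2^-1))%E =
    (c * Num.sqrt (#|` A|%:R * #|` B|%:R))%:E.
  rewrite XA YB !poweR_EFin !powR12_sqrt // -!EFinM.
  by rewrite sqrtrM // mulrA.
move: nu_le; rewrite powE nuE lee_fin => nC.
have AD : #|` A|%:R <= #|` D|%:R :> R by apply: bX.
have BD : #|` B|%:R <= #|` D|%:R :> R by apply: bY.
have nC2 : #|` D|%:R ^+ 2 <= C ^+ 2 * (#|` A|%:R * #|` B|%:R).
  have ab0 : 0 <= #|` A|%:R * #|` B|%:R :> R by rewrite mulr_ge0.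
  rewrite -(sqr_sqrtr ab0) -exprMn.
  by rewrite lerXn2r ?nnegrE ?mulr_ge0 ?sqrtr_ge0 ?(ltW C_gt0).
(* Both sizes are at most [#|D|], so [a b <= n^2 <= C^2 a b]. *)
have C1 : 1 <= C.
  have ab0 : 0 < #|` A|%:R * #|` B|%:R :> R by rewrite mulr_gt0 ?ltr0n.
  rewrite -(@ler_pXn2r _ 2) ?nnegrE ?(ltW C_gt0) // expr1n -(ler_pM2r ab0) mul1r.
  by apply: le_trans nC2; rewrite expr2 ler_pM.
have [H [K [L [E [rH [Km Lm] [netK netL] [netE Em]]]]]] :=
  approx_subgroup_of_small_product epsilon_gt0 beta_ge C1 AX BY A0 B0 sepA sepB
    netD nC2.
(* As [C >= 1], the bounds [8 * C ^+ 4] on [K] and [L] imply the stated ones. *)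
have Cle k : (4 <= k)%N -> C ^+ 4 <= C ^+ k by move=> ?; apply: ler_weXn2l.
have C4 : 0 <= C ^+ 4 by rewrite exprn_ge0 ?ltW.
exists H, K, L; split=> //.
split; first by have := Cle 32%N isT; lra.
split; first by have := Cle 48%N isT; lra.
split=> //; split.
  move=> s /netL[h Hh sh]; exists h => //.
  by apply: lt_le_trans sh _; rewrite lee_fin; lra.
rewrite powE; apply: le_trans (ereal_inf_lbound _) _; first by exists E.
by rewrite lee_fin.
Qed.
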